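(* Let $A$ be an $\ell$-controllable complete group system with generator group $(\mathcal{U},\circ)$, let $\mathbf{f}$ be any normal filling sequence of $\mathbf{n}=\{0,\ldots,\ell\}\times\mathbf{Z}$, and let $\mathbf{u}_{\mathbf 1}=L^0\subset L^1\subset\cdots\subset L^\tau\subset L^{\tau+1}\subset\cdots\subset(\mathcal{U},\circ)$ be the corresponding normal chain. Then the generators of $(\mathcal{U},\circ)$ form a coset representative chain of the coset decomposition chain of $(\mathcal{U},\circ)$ formed by this normal chain: for each $\tau\ge0$, if $(k^+,t^+)$ is the pair of $\mathbf{f}^{\tau+1}$ that is not in $\mathbf{f}^\tau$, then the set of generators $\{\mathbf{u}_{g,k^+}^{t^+}:g_{k^+}^{t^+}\in G_{k^+}^{t^+}\}$ is a complete set of coset representatives (one for each coset) of $L^\tau$ in $L^{\tau+1}$.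
   Context: Let $(A^t)_{t\in\mathbf{Z}}$ be finite groups. A group system $A$ is a set of sequences $\mathbf{a}=(a^t)_{t\in\mathbf{Z}}$, $a^t\in A^t$, forming a group under componentwise operation, such that every element of $A^t$ occurs as a time-$t$ component, for each $t$. $\chi^t:A\to A^t$ is $\mathbf{a}\mapsto a^t$. $A$ is $\ell$-controllable ($\ell>0$) if for every $t\in\mathbf{Z}$ and all $\dot{\mathbf{a}},\ddot{\mathbf{a}}\in A$ there is $\mathbf{a}\in A$ agreeing with $\dot{\mathbf{a}}$ at all times $<t$ and with $\ddot{\mathbf{a}}$ at all times $\ge t+\ell$. $A$ is complete if every sequence in $\prod_t A^t$ whose restriction to each finite interval is the restriction of some element of $A$ belongs to $A$. $A^{[m,n]}$ is the set of sequences in $A$ that are the identity outside $[m,n]$. $X^t$ (resp. $Y^t$) is the normal subgroup of sequences in $A$ that are the identity at all times $<t$ (resp. $>t$). Basis: for $t\in\mathbf{Z}$, $0\le k\le\ell$ put $\Lambda^{[t,t+k]}=X^{t+1}(X^t\cap Y^{t+k})/X^{t+1}(X^t\cap Y^{t+k-1})$. A basis is a choice, for each $(k,t)$, of a transversal $[\Lambda^{[t,t+k]}]$ whose elements (generators $\mathbf{g}^{[t,t+k]}$) lie in $A^{[t,t+k]}$ and in which the trivial coset is represented by the identity sequence. $\mathcal{R}=\prod_{t\in\mathbf{Z}}\prod_{0\le k\le\ell}[\Lambda^{[t,t+k]}]$. The map $\alpha:\mathcal{R}\to A$ sends $\mathbf{r}=(\mathbf{g}^{[t,t+k]})_{k,t}$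 to $\prod_{i=+\infty}^{-\infty}\prod_{m=0}^{\ell}\mathbf{g}^{[i,i+m]}$, i.e. the sequence with time-$t$ component $\prod_{j=0}^{\ell}\bigl(\prod_{k=j}^{\ell}\chi^t(\mathbf{g}^{[t-j,t-j+k]})\bigr)$ (factors written left to right in increasing $j$, and increasing $k$ for each $j$); $\alpha$ is a bijection. The operation $*$ on $\mathcal{R}$ is $\dot{\mathbf{r}}*\ddot{\mathbf{r}}=\alpha^{-1}(\alpha(\dot{\mathbf{r}})\alpha(\ddot{\mathbf{r}}))$. For each $(k,t)$ let $G_k^t$ be a set of labels with a fixed bijection $[\Lambda^{[t,t+k]}]\to G_k^t$, $\mathbf{g}^{[t,t+k]}\mapsto g_k^t$; the trivial label is that of the identity sequence. $\mathcal{U}=\prod_{t\in\mathbf{Z}}\prod_{0\le k\le\ell}G_k^t$, and $\beta:\mathcal{R}\to\mathcal{U}$ replaces each generator by its label. The operation $\circ$ on $\mathcal{U}$ is $\beta(\dot{\mathbf{r}})\circ\beta(\ddot{\mathbf{r}})=\beta(\dot{\mathbf{r}}*\ddot{\mathbf{r}})$; $(\mathcal{U},\circ)$ is the generator group, with identity $\mathbf{u}_{\mathbf 1}$ (all labels trivial). For $g_k^t\in G_k^t$, the generator $\mathbf{u}_{g,k}^t$ of $(\mathcal{U},\circ)$ is the element of $\mathcal{U}$ with label $g_k^t$ at position $(k,t)$ and trivial labels elsewhere. Lower triangles: $D_k^t=\{(m,s):0\le m,\ t\le s,\ s+m\le t+k\}$, for $0\le k\le\ell$. The lower elementary group $\mathcal{L}_k^t$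 is the set of $\mathbf{u}\in\mathcal{U}$ whose labels are trivial outside $D_k^t$; it is the normal subgroup of $(\mathcal{U},\circ)$ corresponding to $A^{[t,t+k]}$ under the isomorphism $\beta\circ\alpha^{-1}:A\to\mathcal{U}$. A filling sequence $\mathbf{f}=(k',t'),(k'',t''),\ldots$ is a sequence listing every pair of $\mathbf{n}$ exactly once; $\mathbf{f}^\tau$ is its list of the first $\tau$ pairs ($\mathbf{f}^0$ empty). $\mathbf{f}$ is normal if for every $\tau>0$ the set of pairs in $\mathbf{f}^\tau$ is a union of lower triangles. For such $\mathbf{f}$, $L^\tau$ ($\tau>0$) is the product, in $(\mathcal{U},\circ)$, of the normal subgroups $\mathcal{L}_k^t$ over the maximal lower triangles $D_k^t$ contained in the set of pairs of $\mathbf{f}^\tau$. *)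

(* Defs.v *)
From HB Require Import structures.
From mathcomp Require Import all_boot all_order all_algebra all_fingroup.
From mathcomp Require Import boolp classical_sets functions.

Set Implicit Arguments.
Unset Strict Implicit.
Unset Printing Implicit Defensive.

Import Order.TTheory GRing.Theory Num.Theory.

Local Open Scope classical_set_scope.
Local Open Scope ring_scope.

(* The operation is a bare argument, because the operation on label arrays is
   obtained by transport along inverses chosen classically. *)
Section RawGroup.
Variables (T : Type) (op : T -> T -> T) (e : T).
Implicit Types (N H S : set T) (x y : T).

Definition set_op (P Q : set T) : set T := [set op x y | x in P & y in Q].

Definition rcoset_of N x : set T := [set op n x | n in N].
Definition lcoset_of N x : set T := [set op x n | n in N].

Definition normal_subgroup N : Prop :=
  [/\ N e,
      forall x y, N x -> N y -> N (op x y),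
      forall x, N x -> exists y, [/\ N y, op x y = e & op y x = e] &
      forall x, lcoset_of N x = rcoset_of N x].

(* Only used when N is normal in H, where right and left cosets coincide. *)
Definition coset_representatives H N S : Prop :=
  S `<=` H /\ forall x, H x -> exists! y, S y /\ rcoset_of N x y.

Definition normal_chain (N : nat -> set T) : Prop :=
  N 0%N = [set e] /\
  forall i, normal_subgroup (N i) /\ N i `<=` N i.+1.

End RawGroup.

Section SequenceGroup.
Variable G : int -> finGroupType.

Definition sequences : Type := forall t : int, G t.

HB.instance Definition _ := gen_eqMixin sequences.
HB.instance Definition _ := gen_choiceMixin sequences.

Definition seq_mul (a b : sequences) : sequences := fun t => (a t * b t)%g.
Definition seq_one : sequences := fun=> 1%g.
Definition seq_inv (a : sequences) : sequences := fun t => (a t)^-1%g.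

Fact seq_mulA : associative seq_mul.
Proof. by move=> a b c; apply: functional_extensionality_dep => t; apply: mulgA. Qed.
Fact seq_1mul : left_id seq_one seq_mul.
Proof. by move=> a; apply: functional_extensionality_dep => t; apply: mul1g. Qed.
Fact seq_mul1 : right_id seq_one seq_mul.
Proof. by move=> a; apply: functional_extensionality_dep => t; apply: mulg1. Qed.
Fact seq_Vmul : left_inverse seq_one seq_inv seq_mul.
Proof. by move=> a; apply: functional_extensionality_dep => t; apply: mulVg. Qed.
Fact seq_mulV : right_inverse seq_one seq_inv seq_mul.
Proof. by move=> a; apply: functional_extensionality_dep => t; apply: mulgV. Qed.

HB.instance Definition _ :=
  isGroup.Build sequences seq_mulA seq_1mul seq_mul1 seq_Vmul seq_mulV.

End SequenceGroup.

Record group_system := GroupSystem {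
  alphabet : int -> finGroupType;
  carrier : set (sequences alphabet);
  carrier1 : carrier 1%g;
  carrierM : forall a b, carrier a -> carrier b -> carrier (a * b)%g;
  carrierV : forall a, carrier a -> carrier a^-1%g;
  carrier_onto : forall t (x : alphabet t), exists2 a, carrier a & a t = x
}.
Arguments carrier : clear implicits.

Definition controllable (A : group_system) (l : nat) : Prop :=
  (0 < l)%N /\
  forall (t : int) (a1 a2 : sequences (alphabet A)), carrier A a1 -> carrier A a2 ->
    exists a, [/\ carrier A a, forall s, s < t -> a s = a1 s &
                       forall s, t + l%:Z <= s -> a s = a2 s].

Definition complete (A : group_system) : Prop :=
  forall a : sequences (alphabet A),
    (forall m n : int, exists2 b, carrier A b & forall t, m <= t <= n -> a t = b t) ->
    carrier A a.

Section Systems.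
Variable A : group_system.

Definition segment (m n : int) : set (sequences (alphabet A)) :=
  [set a | carrier A a /\ forall s, ~~ (m <= s <= n) -> a s = 1%g].

Definition Xsub (t : int) : set (sequences (alphabet A)) :=
  [set a | carrier A a /\ forall s, s < t -> a s = 1%g].

Definition Ysub (t : int) : set (sequences (alphabet A)) :=
  [set a | carrier A a /\ forall s, t < s -> a s = 1%g].

Definition XXY (t u : int) : set (sequences (alphabet A)) :=
  set_op *%g (Xsub (t + 1)) (Xsub t `&` Ysub u).

(* A pair (k, t) stands for the position of the generator g^{[t, t + k]}. *)
Local Notation position l := ('I_l.+1 * int)%type.

Record basis (l : nat) := Basis {
  gens : position l -> set (sequences (alphabet A));
  gens_segment : forall (k : 'I_l.+1) (t : int), gens (k, t) `<=` segment t (t + k%:Z);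
  gens_transversal : forall (k : 'I_l.+1) (t : int),
    coset_representatives *%g (XXY t (t + k%:Z)) (XXY t (t + k%:Z - 1))
      (gens (k, t));
  gens1 : forall p, gens p 1%g
}.

Section Basis.
Variables (l : nat) (B : basis l).

Definition basis_elt (p : position l) : Type := {g | gens B p g}.
Definition basis_elt1 p : basis_elt p := exist _ 1%g (gens1 B p).

Definition Rset : Type := forall p, basis_elt p.
Definition r1 : Rset := basis_elt1.

Definition alpha (r : Rset) : sequences (alphabet A) := fun t =>
  (\prod_(j < l.+1) \prod_(k < l.+1 | (j <= k)%N)
      sval (r (k, (t - j%:Z)%R)) t)%g.

Definition alpha_inv : sequences (alphabet A) -> Rset :=
  'pinv_(fun=> r1) [set: Rset] alpha.

Definition star (r s : Rset) : Rset := alpha_inv (alpha r * alpha s)%g.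

Record labelling := Labelling {
  label : position l -> Type;
  lab : forall p, basis_elt p -> label p;
  lab_bij : forall p, bijective (@lab p)
}.

Section Labels.
Variable G : labelling.

Definition Uset : Type := forall p, label G p.

Definition beta (r : Rset) : Uset := fun p => lab G (r p).
Definition beta_inv : Uset -> Rset := 'pinv_(fun=> r1) [set: Rset] beta.

Definition circ (u v : Uset) : Uset := beta (star (beta_inv u) (beta_inv v)).

Definition u1 : Uset := fun p => lab G (basis_elt1 p).

Definition generator (p : position l) (g : label G p) : Uset := dfwith u1 g.

Definition triangle (p : position l) : set (position l) :=
  [set q : position l | p.2 <= q.2 /\ q.2 + q.1%:Z <= p.2 + p.1%:Z].

Definition lower_group (p : position l) : set Uset :=
  [set u | forall q, ~ triangle p q -> u q = u1 q].

Definition filling (f : nat -> position l) : Prop :=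
  forall p, exists! i, f i = p.

Definition normal_filling (f : nat -> position l) : Prop :=
  filling f /\
  forall tau, (0 < tau)%N -> exists P : set (position l),
    [set` mkseq f tau] = \bigcup_(p in P) triangle p.

Definition maximal_triangle (S : set (position l)) (p : position l) : Prop :=
  triangle p `<=` S /\
  forall q, triangle q `<=` S -> triangle p `<=` triangle q ->
    triangle q = triangle p.

(* Every maximal triangle is indexed by a pair of f^tau, so filtering that list
   enumerates them all; the factors being normal, their order is immaterial.
   The empty product gives the trivial group for tau = 0. *)
Definition Lchain (f : nat -> position l) (tau : nat) : set Uset :=
  \big[set_op circ/[set u1]]_(p <- mkseq f tau |
       `[< maximal_triangle [set` mkseq f tau] p >]) lower_group p.

End Labels.
End Basis.
End Systems.

Arguments circ {A l B} G u v.
Arguments generator {A l B} G p g.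
Arguments Lchain {A l B} G f tau.

(* Main.v *)
(* All work is done in A, through phi = alpha o beta^-1 : U -> A.
   The map alpha is injective: if alpha r = alpha r' and U_i, U'_i denote the
   parts of the two products starting at times >= i, then the sequence
   U'_i^-1 U_i is supported on [i, i + l - 1]; comparing it with the one for
   i + 1 shows, one length k = l, ..., 0 at a time, that the generators agree
   and that the support shrinks. Conversely peeling off rows of generators
   expresses every sequence that starts at a finite time as some alpha r, and
   lower triangles correspond to segments. Hence L^tau corresponds to the
   product K of the segments over the lower triangles inside f^tau.
   For (k, t) = f tau, a sequence in A^[t,t+k] is its coset generator times
   sequences in A^[t+1,t+k] and A^[t,t+k-1], whose triangles are already in
   f^tau. Distinct generators stay in distinct cosets, because no triangle
   inside f^tau contains (k, t), so K lies in X^(t+1) Y^(t+k-1). *)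
Require Import Defs.
From mathcomp Require Import all_boot all_order all_algebra all_fingroup.
From mathcomp Require Import boolp classical_sets functions zify.

Set Implicit Arguments.
Unset Strict Implicit.
Unset Printing Implicit Defensive.

Import Order.TTheory GRing.Theory Num.Theory.

Local Open Scope classical_set_scope.
Local Open Scope ring_scope.

(** * Evaluation of sequences at a time, and splitting of ordered products *)

Section SequenceEvaluation.
Variable G : int -> finGroupType.
Implicit Types a b : sequences G.

Lemma seqP a b : (forall t, a t = b t) -> a = b.
Proof. exact: functional_extensionality_dep. Qed.

Lemma seqM a b t : (a * b)%g t = (a t * b t)%g.
Proof. by []. Qed.

Lemma seqV a t : a^-1%g t = (a t)^-1%g.
Proof. by []. Qed.

Lemma seq_prod I (s : seq I) (P : pred I) (F : I -> sequences G) t :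
  (\prod_(i <- s | P i) F i)%g t = (\prod_(i <- s | P i) F i t)%g.
Proof. exact: (big_morph (fun a : sequences G => a t)). Qed.

End SequenceEvaluation.

(** Since [c] is downward closed, all factors taken from [a] precede those taken from [b], so
    nothing has to commute. *)
Lemma prod_cut (gT : groupType) (c : nat -> bool) (a b : nat -> gT) n :
    (forall i j, (i <= j)%N -> c j -> c i) ->
  (\prod_(j < n) (if c j then a j else b j) =
   (\prod_(j < n) if c j then a j else 1) *
   (\prod_(j < n) if c j then 1 else b j))%g.
Proof.
move=> c_dec; elim: n => [|n IHn]; first by rewrite !big_ord0 mulg1.
rewrite !big_ord_recr /= IHn; case: ifP => cn; last by rewrite mulg1 mulgA.
have c_le j : (j <= n)%N -> c j by move=> le_jn; apply: c_dec le_jn cn.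
have -> : (\prod_(j < n) (if c j then 1 else b j) = 1)%g.
  by apply: big1 => j _; rewrite c_le // ltnW.
by rewrite !mulg1.
Qed.

(** * Normal subgroups of a group system *)

Section NormalSets.
Variable A : group_system.
Implicit Types (a x : sequences (alphabet A)) (K : set (sequences (alphabet A))).

(** The ambient group consists of all sequences over the alphabets, so normality is taken relative
    to [carrier A]. *)
Definition normal_in K : Prop :=
  [/\ K `<=` carrier A, K 1%g, forall x y, K x -> K y -> K (x * y)%g,
      forall x, K x -> K x^-1%g &
      forall a x, carrier A a -> K x -> K (a * x * a^-1)%g].

Lemma normal_inJV K a x :
  normal_in K -> carrier A a -> K x -> K (a^-1 * x * a)%g.
Proof.
move=> [_ _ _ _ KJ] Aa Kx; rewrite -{2}[a]invgK.
by apply: KJ => //; apply: carrierV.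
Qed.

Lemma normal_in_vanishing (T : set int) :
  normal_in [set a | carrier A a /\ forall s, T s -> a s = 1%g].
Proof.
split.
- by move=> a [].
- by split=> //; apply: carrier1.
- move=> x y [Ax x1] [Ay y1]; split=> [|s Ts]; first exact: carrierM.
  by rewrite seqM x1 // y1 // mulg1.
- move=> x [Ax x1]; split=> [|s Ts]; first exact: carrierV.
  by rewrite seqV x1 // invg1.
- move=> a x Aa [Ax x1]; split=> [|s Ts].
    by apply: carrierM; [apply: carrierM | apply: carrierV].
  by rewrite !seqM x1 // seqV mulg1 mulgV.
Qed.

Lemma normal_in_Xsub t : normal_in (@Xsub A t).
Proof. exact: (normal_in_vanishing [set s | s < t]). Qed.

Lemma normal_in_Ysub t : normal_in (@Ysub A t).
Proof. exact: (normal_in_vanishing [set s | t < s]). Qed.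

Lemma normal_in_segment m n : normal_in (@segment A m n).
Proof. exact: (normal_in_vanishing [set s | ~~ (m <= s <= n)]). Qed.

Lemma normal_inI K1 K2 : normal_in K1 -> normal_in K2 -> normal_in (K1 `&` K2).
Proof.
move=> [A1 o1 M1 V1 J1] [A2 o2 M2 V2 J2]; split=> //.
- by move=> x [/A1].
- by move=> x y [? ?] [? ?]; split; [apply: M1 | apply: M2].
- by move=> x [? ?]; split; [apply: V1 | apply: V2].
- by move=> a x Aa [? ?]; split; [apply: J1 | apply: J2].
Qed.

Lemma normal_in_set_op K1 K2 :
  normal_in K1 -> normal_in K2 -> normal_in (set_op *%g K1 K2).
Proof.
move=> N1 N2; have [A1 o1 M1 V1 J1] := N1; have [A2 o2 M2 V2 J2] := N2; split.
- by move=> _ [x K1x [y K2y <-]]; apply: carrierM; [apply: A1 | apply: A2].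
- by exists 1%g => //; exists 1%g => //; rewrite mulg1.
- move=> _ _ [x K1x [y K2y <-]] [x' K1x' [y' K2y' <-]].
  exists (x * (y * x' * y^-1))%g.
    by apply: M1 => //; apply: J1 => //; apply: A2.
  by exists (y * y')%g; [apply: M2 | rewrite !mulgA mulgVK].
- move=> _ [x K1x [y K2y <-]]; exists x^-1%g; first exact: V1.
  exists (x * y^-1 * x^-1)%g; last by rewrite invgM !mulgA mulVg mul1g.
  by apply: J2; [apply: A1 | apply: V2].
- move=> a _ Aa [x K1x [y K2y <-]]; exists (a * x * a^-1)%g; first exact: J1.
  by exists (a * y * a^-1)%g; [apply: J2 | rewrite !mulgA mulgVK].
Qed.

Lemma normal_in_XXY t u : normal_in (@XXY A t u).
Proof.
apply: normal_in_set_op; first exact: normal_in_Xsub.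
by apply: normal_inI; [apply: normal_in_Xsub | apply: normal_in_Ysub].
Qed.

Lemma Xsub_mono s t : s <= t -> @Xsub A t `<=` @Xsub A s.
Proof. by move=> le_st a [Aa a1]; split=> // u ltu; apply: a1; lia. Qed.

Lemma Ysub_mono s t : s <= t -> @Ysub A s `<=` @Ysub A t.
Proof. by move=> le_st a [Aa a1]; split=> // u ltu; apply: a1; lia. Qed.

Lemma segmentE m n : @segment A m n = @Xsub A m `&` @Ysub A n.
Proof.
apply/seteqP; split=> a.
  move=> [Aa a1]; split; split=> // s lts; apply: a1; lia.
move=> [[Aa aX] [_ aY]]; split=> // s; rewrite negb_and -!ltNge.
by case/orP; [apply: aX | apply: aY].
Qed.

Lemma segment_mono m n m' n' :
  m' <= m -> n <= n' -> @segment A m n `<=` @segment A m' n'.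
Proof.
move=> le_m le_n a; rewrite !segmentE.
by move=> [/(Xsub_mono le_m) Xa /(Ysub_mono le_n)].
Qed.

Lemma segment_empty m n : n < m -> @segment A m n `<=` [set 1%g].
Proof. by move=> lt_nm a [_ a1]; apply: seqP => s; apply: a1; lia. Qed.

Lemma XXY_meet t u : @Xsub A t `&` @Ysub A u `<=` @XXY A t u.
Proof.
move=> x XYx; exists 1%g; first by have [] := normal_in_Xsub (t + 1).
by exists x => //; rewrite mul1g.
Qed.

Lemma XXY_empty t : @XXY A t (t - 1) `<=` @Xsub A (t + 1).
Proof.
move=> _ [x Xx [y XYy <-]]; rewrite -segmentE in XYy.
by rewrite (segment_empty _ XYy) ?mulg1 //; lia.
Qed.

(** The interpolant [b] equals [a] before [t + 1] and is trivial from [t + 1 + l] on, so it is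
    supported on [[t, t + l]]; dividing it out moves the start of [a] to [t + 1]. Controllability
    enters the proof only here. *)
Lemma Xsub_controllable l t : controllable A l ->
  @Xsub A t `<=` @XXY A t (t + l%:Z).
Proof.
move=> [_ ctrl] a [Aa a1].
have [b [Ab ba b1]] := ctrl (t + 1) a 1%g Aa (carrier1 A).
exists (a * b^-1)%g.
  split=> [|s lts]; first by apply: carrierM => //; apply: carrierV.
  by rewrite seqM seqV ba // mulgV.
exists b; last by rewrite mulgVK.
split; split=> // s lts; first by rewrite ba ?a1 //; lia.
by rewrite b1 //; lia.
Qed.

End NormalSets.

(** * The map [alpha]: rows, truncation, membership in [A], injectivity *)

Section AlphaTheory.
Variables (A : group_system) (l : nat) (B : basis A l).
Implicit Types (r : Rset B) (i s t u : int) (x : sequences (alphabet A)).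

Lemma basis_elt_inj p (g h : basis_elt B p) : sval g = sval h -> g = h.
Proof.
case: g h => [g Bg] [h Bh] /= eq_gh; subst h.
by congr exist; apply: Prop_irrelevance.
Qed.

Lemma RsetP r r' : (forall p, sval (r p) = sval (r' p)) -> r = r'.
Proof.
by move=> e; apply: functional_extensionality_dep => p; apply: basis_elt_inj.
Qed.

Lemma gens_sub p : gens B p `<=` @segment A p.2 (p.2 + p.1%:Z).
Proof. by case: p => k t; apply: gens_segment. Qed.

Lemma gens_uniq (k : 'I_l.+1) t g h :
    gens B (k, t) g -> gens B (k, t) h ->
  @XXY A t (t + k%:Z - 1) (h * g^-1)%g -> h = g.
Proof.
move=> Bg Bh Nhg; have [sub uniq] := gens_transversal B k t.
have [z [_ z_uniq]] := uniq g (sub g Bg).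
have <- : z = g.
  apply: z_uniq; split=> //; exists 1%g; last exact: mul1g.
  by have [] := normal_in_XXY A t (t + k%:Z - 1).
by symmetry; apply: z_uniq; split=> //; exists (h * g^-1)%g; rewrite // mulgVK.
Qed.

Definition row r i : sequences (alphabet A) :=
  (\prod_(k < l.+1) sval (r (k, i)))%g.

Lemma row_Xsub r i : @Xsub A i (row r i).
Proof.
have [_ X1 XM _ _] := normal_in_Xsub A i.
apply: (big_ind (@Xsub A i)) => // k _; have := gens_sub (svalP (r (k, i))).
by rewrite segmentE => -[].
Qed.

Lemma alpha_row r t : alpha r t = (\prod_(j < l.+1) row r (t - j%:Z) t)%g.
Proof.
apply: eq_bigr => j _; rewrite /row seq_prod big_mkcond /=; apply: eq_bigr => k _.
case: leqP => // lt_kj; have [_ -> //] := gens_sub (svalP (r (k, t - j%:Z))).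
by rewrite /=; lia.
Qed.

Lemma alpha_local r r' t :
  (forall i, t - l%:Z <= i <= t -> row r i = row r' i) -> alpha r t = alpha r' t.
Proof.
move=> eq_row; rewrite !alpha_row; apply: eq_bigr => j _.
by rewrite eq_row //; have := ltn_ord j; lia.
Qed.

Lemma row_r1 i : row (r1 B) i = 1%g.
Proof. by apply: big1. Qed.

Lemma alpha_r1 : alpha (r1 B) = 1%g.
Proof.
by apply: seqP => t; rewrite alpha_row big1 // => j _; rewrite row_r1.
Qed.

(** With [r1 B] in one slot this truncates an array at time [i]; [alpha] of the truncations gives
    the partial products compared in [alpha_inj]. *)
Definition cut i r r' : Rset B := fun p => if i <= p.2 then r p else r' p.

Lemma row_cut i r r' s :
  row (cut i r r') s = if i <= s then row r s else row r' s.
Proof. by rewrite /row /cut /=; case: ifP. Qed.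

(** In [alpha], rows with a later start stand further to the left, so a cut by starting time splits
    the product into a left and a right factor. *)
Lemma alpha_cut i r r' :
  alpha (cut i r r') = (alpha (cut i r (r1 B)) * alpha (cut i (r1 B) r'))%g.
Proof.
apply: seqP => t; rewrite seqM !alpha_row.
pose c j := i <= t - j%:Z; pose a j := row r (t - j%:Z) t.
pose b j := row r' (t - j%:Z) t.
transitivity (\prod_(j < l.+1) if c j then a j else b j)%g.
  by apply: eq_bigr => j _; rewrite row_cut /c; case: ifP.
rewrite prod_cut => [|m n le_mn]; last by rewrite /c; lia.
by congr (_ * _)%g; apply: eq_bigr => j _; rewrite row_cut row_r1 /c; case: ifP.
Qed.

Lemma alpha_cut_row i r :
  alpha (cut i r (r1 B)) = (alpha (cut (i + 1) r (r1 B)) * row r i)%g.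
Proof.
(* [only] keeps row [i] of [r] and nothing else. *)
pose only := cut i (cut (i + 1) (r1 B) r) (r1 B).
have -> : cut i r (r1 B) = cut (i + 1) r only.
  apply: RsetP => p; rewrite /only /cut.
  by case: (leP i); case: (leP (i + 1)) => //; lia.
rewrite alpha_cut; congr (_ * _)%g; apply: seqP => t.
have row_only s :
    row (cut (i + 1) (r1 B) only) s = if s == i then row r i else 1%g.
  rewrite !row_cut row_r1; case: (eqVneq s i) => [->|] /=.
    by rewrite lexx; have -> : (i + 1 <= i) = false by lia.
  by case: ifP => //; case: ifP => //; lia.
(* Row [i] can be nontrivial only at times in [[i, i + l]], where it is the factor of index
   [j = t - i]; elsewhere both sides are trivial. *)
rewrite alpha_row; case: (boolP (i <= t <= i + l%:Z)) => it.
  have lt_j : (`|t - i| < l.+1)%N by lia.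
  transitivity (\prod_(j < l.+1 | j == Ordinal lt_j) row r i t)%g; last first.
    by rewrite big_pred1_eq.
  rewrite [RHS]big_mkcond; apply: eq_bigr => j _; rewrite row_only -val_eqE /=.
  have -> : (t - j%:Z == i) = (nat_of_ord j == `|t - i|%N) by apply/eqP/eqP; lia.
  by case: ifP.
rewrite big1 => [|j _]; last first.
  by rewrite row_only; case: eqP => //; have := ltn_ord j; lia.
symmetry; rewrite /row seq_prod big1 // => k _.
have [_ -> //] := gens_sub (svalP (r (k, i))).
by have := ltn_ord k; rewrite /=; lia.
Qed.

Lemma alpha_dfwith p (g : basis_elt B p) : alpha (dfwith (r1 B) g) = sval g.
Proof.
case: p g => k i g; set r := dfwith _ g.
have r_out (p : 'I_l.+1 * int) : (k, i) != p -> r p = r1 B p by apply: dfwith_out.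
have -> : r = cut i r (r1 B).
  apply: RsetP => p; rewrite /cut; case: leP => // lt_pi.
  by rewrite r_out //; apply: contraTneq lt_pi => <-; rewrite ltxx.
rewrite alpha_cut_row; have -> : cut (i + 1) r (r1 B) = r1 B.
  apply: RsetP => p; rewrite /cut; case: leP => // lt_ip.
  by rewrite r_out //; apply: contraTneq lt_ip => <- /=; lia.
rewrite alpha_r1 mul1g /row.
transitivity (\prod_(j < l.+1 | j == k) sval g)%g; last by rewrite big_pred1_eq.
rewrite [RHS]big_mkcond; apply: eq_bigr => j _.
case: eqP => [->|ne_jk]; first by rewrite /r dfwith_in.
by rewrite r_out //; apply: contra_notN ne_jk => /eqP[].
Qed.

Lemma row_carrier r i : carrier A (row r i).
Proof. by have [] := row_Xsub r i. Qed.

Lemma alpha_finite_carrier n i r :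
    (forall p : 'I_l.+1 * int, ~~ (i <= p.2 < i + n%:Z) -> r p = r1 B p) ->
  carrier A (alpha r).
Proof.
elim: n i r => [|n IHn] i r r_fin.
  have -> : r = r1 B by apply: RsetP => p; rewrite r_fin //; lia.
  by rewrite alpha_r1; apply: carrier1.
have -> : r = cut i r (r1 B).
  apply: RsetP => p; rewrite /cut; case: leP => // lt_pi.
  by rewrite r_fin //; lia.
rewrite alpha_cut_row; apply: carrierM; last exact: row_carrier.
apply: (IHn (i + 1)) => p np; rewrite /cut; case: leP => // lt_ip.
by apply: r_fin; lia.
Qed.

Lemma cut_after i r t : t < i -> alpha (cut i r (r1 B)) t = 1%g.
Proof.
move=> lt_ti; rewrite alpha_row big1 // => j _; rewrite row_cut row_r1.
by case: leP => //; lia.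
Qed.

Lemma cut_before i r t : i + l%:Z - 1 < t -> alpha (cut i (r1 B) r) t = 1%g.
Proof.
move=> lt_it; rewrite alpha_row big1 // => j _; rewrite row_cut row_r1.
by case: leP => //; have := ltn_ord j; lia.
Qed.

Hypothesis hcomplete : complete A.

(** At times in [[m, n]] only the rows from [m - l] to [n] contribute. Truncating to them gives a
    finite product, hence an element of [A], and completeness concludes. *)
Lemma alpha_carrier r : carrier A (alpha r).
Proof.
apply: hcomplete => m n.
exists (alpha (cut (m - l%:Z) (cut (n + 1) (r1 B) r) (r1 B))).
  apply: (@alpha_finite_carrier (absz (n - m + l%:Z + 1)%R) (m - l%:Z)) => p np.
  rewrite /cut; case: leP => // le1; case: leP => // le2. lia.
move=> t mtn; apply: alpha_local => i it; rewrite !row_cut.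
have -> : m - l%:Z <= i by lia.
by have -> : (n + 1 <= i) = false by lia.
Qed.

Lemma cut_Xsub i r : @Xsub A i (alpha (cut i r (r1 B))).
Proof. by split=> [|t /cut_after]; [apply: alpha_carrier | apply]. Qed.

Lemma cut_Ysub i r : @Ysub A (i + l%:Z - 1) (alpha (cut i (r1 B) r)).
Proof. by split=> [|t /cut_before]; [apply: alpha_carrier | apply]. Qed.

Definition subrow r i m n : sequences (alphabet A) :=
  (\prod_(m <= k < n) sval (r (inord k, i)))%g.

Lemma row_split r i (k : 'I_l.+1) :
  row r i = (subrow r i 0 k * sval (r (k, i)) * subrow r i k.+1 l.+1)%g.
Proof.
have -> : sval (r (k, i)) = sval (r (inord k, i)) by rewrite inord_val.
rewrite /subrow -mulgA -big_ltn ?ltn_ord //.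
rewrite -big_cat_nat ?big_mkord //=; last exact/ltnW/ltn_ord.
by apply: eq_bigr => m _; rewrite inord_val.
Qed.

Lemma subrow_segment r i n : (n <= l.+1)%N ->
  @segment A i (i + n%:Z - 1) (subrow r i 0 n).
Proof.
move=> le_nl; have [_ S1 SM _ _] := normal_in_segment A i (i + n%:Z - 1).
rewrite /subrow big_nat; apply: (big_ind (@segment A i _)) => // k /andP[_ lt_kn].
have := gens_sub (svalP (r (inord k, i))).
by apply: segment_mono; rewrite /= ?inordK; lia.
Qed.

Lemma subrow_carrier r i m n : carrier A (subrow r i m n).
Proof.
apply: (big_ind (carrier A)); [exact: carrier1 | exact: carrierM |].
by move=> k _; have [] := gens_sub (svalP (r (inord k, i))).
Qed.

(** Modulo [XXY i (i + k - 1)] the relation reduces to equality of the cosets of [g] and [g'], so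
    the transversal forces [g' = g]. Solving for [w] then writes it as a product of sequences on the
    shorter segment. *)
Lemma gens_cancel (k : 'I_l.+1) i g g' q q' w v :
    gens B (k, i) g -> gens B (k, i) g' ->
    @segment A i (i + k%:Z - 1) q -> @segment A i (i + k%:Z - 1) q' ->
    @Xsub A (i + 1) w -> @segment A i (i + k%:Z - 1) v ->
    (q' * g' * v = w * q * g)%g ->
  g' = g /\ @Ysub A (i + k%:Z - 1) w.
Proof.
move=> Bg Bg' Sq Sq' Xw Sv e.
have Ag : carrier A g by have [] := gens_sub Bg.
have Aq : carrier A q by have [] := Sq.
have Aq' : carrier A q' by have [] := Sq'.
have [_ _ SM SV SJ] := normal_in_segment A i (i + k%:Z - 1).
have eq_g : g' = g.
  apply: (gens_uniq Bg Bg').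
  (* Solving for [g' * g^-1], a conjugate of [w] splits off on the left and the remaining factors
     lie in the shorter segment. *)
  exists (q'^-1 * w * q')%g; first exact: normal_inJV (normal_in_Xsub _ _) _ _.
  exists (q'^-1 * q * (g * v^-1 * g^-1))%g.
    rewrite -segmentE; apply: (SM); first by apply: (SM) => //; apply: (SV).
    by apply: (SJ) => //; apply: (SV).
  have -> : g' = (q'^-1 * (w * q * g) * v^-1)%g.
    by rewrite -e !mulgA mulVg mul1g mulgK.
  by rewrite !mulgA mulgK.
split=> //; have -> : w = (q' * (g * v * g^-1) * q^-1)%g.
  by rewrite eq_g in e; rewrite !mulgA e !mulgK.
suff : @segment A i (i + k%:Z - 1) (q' * (g * v * g^-1) * q^-1)%g.
  by rewrite segmentE => -[].
by apply: (SM); [apply: (SM) => //; apply: (SJ) | apply: (SV)].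
Qed.

Lemma alpha_inj : injective (@alpha A l B).
Proof.
move=> r r' eq_rr'.
pose U i := alpha (cut i r (r1 B)); pose U' i := alpha (cut i r' (r1 B)).
pose V i := alpha (cut i (r1 B) r); pose V' i := alpha (cut i (r1 B) r').
pose w i := ((U' i)^-1 * U i)%g.
(* The definition of [w i] shows that it starts at [i] or later; this second expression shows that
   it ends by [i + l - 1]. *)
have wV i : w i = (V' i * (V i)^-1)%g.
  have cut_id r0 : cut i r0 r0 = r0 by apply: RsetP => p; rewrite /cut; case: ifP.
  have : (U i * V i = U' i * V' i)%g by rewrite -!alpha_cut !cut_id.
  move=> eqUV; rewrite /w; apply: (mulIg (V i)).
  by rewrite mulgVK -mulgA eqUV mulKg.
have wX i : @Xsub A i (w i).
  have [_ _ XM XV _] := normal_in_Xsub A i.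
  by apply: XM; [apply: XV|]; apply: cut_Xsub.
have w_rec i : (row r' i * w i = w (i + 1) * row r i)%g.
  rewrite /w /U /U' (alpha_cut_row i r) (alpha_cut_row i r') invgM.
  by rewrite !mulgA mulgV mul1g.
(* [m] counts the lengths already settled, from [l] downwards: generators of length above [l - m]
   agree, and [w i] is supported on [[i, i + l - m - 1]]. *)
suff claim : forall m, (m <= l.+1)%N ->
    (forall i, @Ysub A (i + l%:Z - m%:Z - 1) (w i)) /\
    forall (k : 'I_l.+1) i, (l < k + m)%N -> r (k, i) = r' (k, i).
  have [_ eq_r] := claim l.+1 (leqnn _).
  by apply: RsetP => -[k i]; rewrite eq_r //; lia.
elim=> [_|m IHm lt_ml].
  split=> [i|k i]; last by have := ltn_ord k; lia.
  have [_ _ YM YV _] := normal_in_Ysub A (i + l%:Z - 1).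
  rewrite wV; have -> : i + l%:Z - 0%N%:Z - 1 = i + l%:Z - 1 by lia.
  by apply: YM; [|apply: YV]; apply: cut_Ysub.
have {IHm} [wY eq_r] := IHm (ltnW lt_ml).
have lt_k : (l - m < l.+1)%N by lia.
pose k := Ordinal lt_k; have lt_k' := ltnW lt_k.
(* Generators longer than [k = l - m] already agree, so both rows end in the same factor [h i];
   cancelling it replaces [w i] by its conjugate [v i]. *)
pose h i := subrow r i k.+1 l.+1; pose v i := (h i * w i * (h i)^-1)%g.
have rowE i : row r i = (subrow r i 0 k * sval (r (k, i)) * h i)%g.
  exact: row_split.
have row'E i : row r' i = (subrow r' i 0 k * sval (r' (k, i)) * h i)%g.
  rewrite (row_split _ _ k) /h /subrow; congr (_ * _)%g.
  rewrite !(big_nat _ _ k.+1); apply: eq_bigr => n /andP[lt_kn lt_nl].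
  by rewrite eq_r // inordK //; move: lt_kn => /=; lia.
have vS i : @segment A i (i + k%:Z - 1) (v i).
  have [_ _ _ _ SJ] := normal_in_segment A i (i + k%:Z - 1).
  apply: (SJ); first exact: subrow_carrier.
  rewrite segmentE; split=> //.
  by have -> : i + k%:Z - 1 = i + l%:Z - m%:Z - 1 by rewrite /=; lia.
have v_rec i : (subrow r' i 0 k * sval (r' (k, i)) * v i =
    w (i + 1) * subrow r i 0 k * sval (r (k, i)))%g.
  have := w_rec i; rewrite rowE row'E => e; apply: (mulIg (h i)).
  by rewrite /v !mulgA mulgVK -!mulgA; rewrite -!mulgA in e.
have step i : r' (k, i) = r (k, i) /\ @Ysub A (i + k%:Z - 1) (w (i + 1)).
  have [|eq_g wY1] := gens_cancel (svalP (r (k, i))) (svalP (r' (k, i)))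
    (subrow_segment r i lt_k') (subrow_segment r' i lt_k') _ (vS i) (v_rec i).
    exact: wX.
  by split=> //; apply: basis_elt_inj.
split=> [i|n i lt_ln].
  (* [step] bounds [w (i + 1)], so the bound on [w i] is read off at [i - 1]. *)
  have -> : i + l%:Z - m.+1%:Z - 1 = i - 1 + k%:Z - 1 by rewrite /=; lia.
  by have [_] := step (i - 1); rewrite subrK.
have [/eq_r //|le_n] := ltnP l (n + m)%N.
have -> : n = k by apply: val_inj => /=; lia.
by have [->] := step i.
Qed.

(** * Surjectivity of [alpha] onto sequences with a finite start *)

Hypothesis hcontrollable : controllable A l.

(** Coset representatives are divided out on the right from length [l] down to [0], each leaving a
    remainder one step shorter modulo [Xsub (i + 1)]. The second clause tracks where [x] ends, which
    [alpha_segment] needs. *)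
Lemma row_exists i x : @Xsub A i x ->
  exists y : forall k : 'I_l.+1, basis_elt B (k, i),
    @Xsub A (i + 1) (x * (\prod_(k < l.+1) sval (y k))^-1)%g /\
    forall k : 'I_l.+1, @Ysub A (i + k%:Z - 1) x -> sval (y k) = 1%g.
Proof.
move=> Xx.
suff claim m x0 : (m <= l.+1)%N -> @Xsub A i x0 -> @XXY A i (i + m%:Z - 1) x0 ->
    exists y : nat -> sequences (alphabet A),
    [/\ forall k, gens B (inord k, i) (y k),
        @Xsub A (i + 1) (x0 * (\prod_(0 <= k < m) y k)^-1)%g &
        forall k, (k < m)%N -> @Ysub A (i + k%:Z - 1) x0 -> y k = 1%g].
  have [|y [By Xy y1]] := claim l.+1 x (leqnn _) Xx.
    have -> : i + l.+1%:Z - 1 = i + l%:Z by lia.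
    exact: Xsub_controllable.
  have By' (k : 'I_l.+1) : gens B (k, i) (y k) by rewrite -{1}[k]inord_val.
  exists (fun k : 'I_l.+1 => exist _ (y k) (By' k)).
  by split=> [|k]; [rewrite big_mkord in Xy | apply: y1].
elim: m x0 {x Xx} => [|m IHm] x le_ml Xx.
  have -> : i + 0%N%:Z - 1 = i - 1 by lia.
  move=> /XXY_empty Xx1; exists (fun=> 1%g); split=> // [k|]; first exact: gens1.
  by rewrite big_nil invg1 mulg1.
have -> : i + m.+1%:Z - 1 = i + (inord m : 'I_l.+1)%:Z by rewrite inordK //; lia.
set k := (inord m : 'I_l.+1) => Nx; have km : nat_of_ord k = m by rewrite inordK.
have [sub uniq] := gens_transversal B k i.
have [z [[Bz [n Nn nxz]] _]] := uniq x Nx.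
(* If [x] already ends before [i + m], it lies in the smaller subgroup, so the identity represents
   its coset and uniqueness gives [z = 1]. *)
have z1 : @Ysub A (i + m%:Z - 1) x -> z = 1%g.
  move=> Yx; have [z0 [_ z0_uniq]] := uniq x Nx.
  have <- : z0 = z by apply: z0_uniq; split=> //; exists n.
  apply: z0_uniq; split; first exact: gens1.
  exists x^-1%g; last by rewrite mulVg.
  have [_ _ _ NV _] := normal_in_XXY A i (i + k%:Z - 1).
  by apply: NV; apply: XXY_meet; rewrite km.
have Az : @Xsub A i z by have := gens_sub Bz; rewrite segmentE => -[].
have xz : (x * z^-1)%g = n^-1%g by rewrite -nxz invgM mulKVg.
have Xxz : @Xsub A i (x * z^-1)%g.
  by have [_ _ XM XV _] := normal_in_Xsub A i; apply: XM => //; apply: XV.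
have [|y [By Xy y1]] := IHm (x * z^-1)%g (ltnW le_ml) Xxz.
  have [_ _ _ NV _] := normal_in_XXY A i (i + k%:Z - 1).
  by rewrite xz -km; apply: NV.
exists (fun j => if j == m then z else y j); split.
- by move=> j; case: eqP => [->|].
- rewrite big_nat_recr //= eqxx invgM mulgA.
  rewrite (@eq_big_nat _ _ _ _ _ _ y) // => j lt_jm.
  by case: eqP => // eq_jm; lia.
- move=> j le_jl Yx; case: eqP => [eq_jm|ne_jm].
    by apply: z1; rewrite -eq_jm.
  have lt_jm : (j < m)%N by lia.
  apply: y1 => //; rewrite z1 ?invg1 ?mulg1 //.
  by apply: Ysub_mono Yx; lia.
Qed.

(** Rows are peeled off from time [t] upwards; after [n] of them the remainder [rem n] starts at
    [t + n], so each component is settled after finitely many steps. *)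
Lemma alpha_surj t x : @Xsub A t x ->
  exists r, [/\ alpha r = x, forall p : 'I_l.+1 * int, p.2 < t -> r p = r1 B p &
    forall u, @Ysub A u x ->
      forall p : 'I_l.+1 * int, u < p.2 + p.1%:Z -> r p = r1 B p].
Proof.
move=> Xx.
pose good i (y : sequences (alphabet A))
    (Y : forall k : 'I_l.+1, basis_elt B (k, i)) :=
  @Xsub A (i + 1) (y * (\prod_(k < l.+1) sval (Y k))^-1)%g /\
  forall k : 'I_l.+1, @Ysub A (i + k%:Z - 1) y -> sval (Y k) = 1%g.
(* The condition on [y] sits inside the existential, so that choice yields a function total in
   [y]. *)
have good_ex i y : exists Y, @Xsub A i y -> good i y Y.
  have [/row_exists [Y gY]|nX] := pselect (@Xsub A i y); first by exists Y.
  by exists (fun k => basis_elt1 B (k, i)) => /nX.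
pose Y i := projT1 (choice (good_ex i)).
have YP i y : @Xsub A i y -> good i y (Y i y).
  exact: (projT2 (choice (good_ex i))).
pose R i y := (\prod_(k < l.+1) sval (Y i y k))%g.
pose fix rem n :=
  if n is m.+1 then (rem m * (R (t + m%:Z)%R (rem m))^-1)%g else x.
have remX n : @Xsub A (t + n%:Z) (rem n).
  elim: n => [|n IHn]; first by have -> : t + 0%N%:Z = t by lia.
  by have -> : t + n.+1%:Z = t + n%:Z + 1; [lia | have [] := YP _ _ IHn].
pose r : Rset B := fun p => match p return basis_elt B p with (k, i) =>
  if t <= i then Y i (rem (absz (i - t)%R)) k else basis_elt1 B (k, i) end.
have rowr n : row r (t + n%:Z) = R (t + n%:Z) (rem n).
  rewrite /row /r; have -> : t <= t + n%:Z by lia.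
  by have -> : absz (t + n%:Z - t)%R = n by lia.
have r_before (p : 'I_l.+1 * int) : p.2 < t -> r p = r1 B p.
  by case: p => k i /= lt_it; have -> : (t <= i) = false by lia.
(* [z] is the product of the first [n] rows, a common right factor of [x] and [alpha r]. *)
have tail n : exists z, x = (rem n * z)%g /\
    alpha r = (alpha (cut (t + n%:Z) r (r1 B)) * z)%g.
  elim: n => [|n [z [xz rz]]].
    exists 1%g; rewrite !mulg1; split=> //; congr alpha; apply: RsetP => p.
    rewrite /cut; case: leP => // lt_pt; rewrite r_before //; lia.
  exists (R (t + n%:Z) (rem n) * z)%g; rewrite {1}xz rz; split.
    by rewrite /= mulgA mulgVK.
  rewrite alpha_cut_row rowr mulgA; congr (alpha (cut _ _ _) * _ * _)%g; lia.
exists r; split=> //.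
  (* After [|s - t| + 1] rows both left factors start after [s], also when [s < t], and only [z]
     remains. *)
  apply: seqP => s; have [z [-> ->]] := tail (absz (s - t)%R).+1.
  have [_ rem1] := remX (absz (s - t)%R).+1.
  by rewrite !seqM cut_after ?rem1 //; lia.
move=> u Yx.
have Y1 i y (k : 'I_l.+1) :
    @Xsub A i y -> @Ysub A u y -> u < i + k%:Z -> sval (Y i y k) = 1%g.
  move=> Xy Yy lt_uk; have [_ -> //] := YP i y Xy.
  by apply: Ysub_mono Yy; lia.
have remY n : @Ysub A u (rem n).
  elim: n => [|n IHn] //=.
  have [_ one YM YV _] := normal_in_Ysub A u; apply: (YM) => //; apply: YV.
  apply: (big_ind (@Ysub A u)) => // k _.
  case: (leP (t + n%:Z + k%:Z) u) => [le_ku|lt_uk]; last by rewrite Y1.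
  have := gens_sub (svalP (Y (t + n%:Z) (rem n) k)).
  by rewrite segmentE => -[_]; apply: Ysub_mono.
move=> [k i] /= lt_uk; case: (leP t i) => // le_ti; apply: basis_elt_inj.
apply: Y1 => //; have := remX (absz (i - t)%R).
by have -> : t + (absz (i - t)%R)%:Z = i by lia.
Qed.

(** Rows before [t] are kept. Moving [x] leftwards across their product [v] conjugates it, and the
    part starting at [t] is again realised by [alpha_surj]. *)
Lemma alpha_mulr r t x : @Xsub A t x -> exists r', alpha r' = (alpha r * x)%g.
Proof.
move=> Xx; pose v := alpha (cut t (r1 B) r).
have cutE : alpha r = (alpha (cut t r (r1 B)) * v)%g.
  by rewrite -alpha_cut; congr alpha; apply: RsetP => p; rewrite /cut; case: ifP.
have [_ _ XM _ XJ] := normal_in_Xsub A t.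
have Xvx := XJ v x (alpha_carrier _) Xx.
have [r' [r'E r'1 _]] := alpha_surj (XM _ _ (cut_Xsub t r) Xvx).
exists (cut t r' r); rewrite alpha_cut -/v cutE.
have -> : cut t r' (r1 B) = r'.
  by apply: RsetP => p; rewrite /cut; case: leP => // /r'1 ->.
by rewrite r'E !mulgA mulgVK.
Qed.

Lemma alpha_mull r t x : @Xsub A t x -> exists r', alpha r' = (x * alpha r)%g.
Proof.
move=> Xx; have Xx' := normal_inJV (normal_in_Xsub A t) (alpha_carrier r) Xx.
have [r' r'E] := alpha_mulr r Xx'; exists r'.
by rewrite r'E -mulgA mulVKg.
Qed.

(** A triangle collects the generators supported in its segment. Conversely [alpha_surj] builds an
    array confined to the triangle, and injectivity identifies it with [r]. *)
Lemma alpha_segment r (p : 'I_l.+1 * int) :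
  @segment A p.2 (p.2 + p.1%:Z) (alpha r) <->
  forall q, ~ triangle p q -> r q = r1 B q.
Proof.
split=> [|r1r].
  rewrite segmentE => -[Xr Yr]; have [r' [r'E r'X r'Y]] := alpha_surj Xr.
  have <- : r' = r by apply: alpha_inj.
  move=> q ntri; have [lt_q|le_q] := ltP q.2 p.2; first exact: r'X.
  apply: (r'Y _ Yr); rewrite ltNge; apply/negP => le_q2; exact: ntri.
split=> [|s ns]; first exact: alpha_carrier.
rewrite alpha_row big1 // => j _; rewrite /row seq_prod big1 // => k _.
have [tri|ntri] := pselect (triangle p (k, s - j%:Z)); last by rewrite r1r.
have [_ -> //] := gens_sub (svalP (r (k, s - j%:Z))).
by case: tri => /=; lia.
Qed.
End AlphaTheory.

(** * Transport between [A] and the label arrays *)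

Section GeneratorGroup.
Variables (A : group_system) (l : nat) (B : basis A l) (G : labelling B).
Hypotheses (hcomplete : complete A) (hcontrollable : controllable A l).
Implicit Types (K : set (sequences (alphabet A))) (u v : Uset G).

Lemma beta_inj : injective (@beta A l B G).
Proof.
move=> r r' eq_beta; apply: functional_extensionality_dep => p.
by apply: (bij_inj (lab_bij G p)); apply: (congr1 (fun u : Uset G => u p) eq_beta).
Qed.

Lemma betaK r : beta_inv (beta G r) = r.
Proof.
apply: beta_inj; apply: (surjpK _ (A := setT) (B := range (beta G))).
  exact: image_subset.
by apply/mem_set; exists r.
Qed.

Lemma beta_invK u : beta G (beta_inv u) = u.
Proof.
apply: (surjpK _ (A := setT) (B := setT)) => [v _|]; last exact/mem_set.
have lab_surj p : exists g, lab G g = v p.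
  by have [f _ fK] := lab_bij G p; exists (f (v p)).
exists (fun p => projT1 (cid (lab_surj p))) => //.
by apply: functional_extensionality_dep => p; apply: (projT2 (cid (lab_surj p))).
Qed.

Lemma alphaK (r : Rset B) x : alpha r = x -> alpha (alpha_inv B x) = x.
Proof.
move=> <-; apply: (surjpK _ (A := setT) (B := range (@alpha A l B))).
  exact: image_subset.
by apply/mem_set; exists r.
Qed.

Definition phi u : sequences (alphabet A) := alpha (beta_inv u).

Lemma phi_inj : injective phi.
Proof.
move=> u v /(alpha_inj hcomplete) eq_uv.
by rewrite -(beta_invK u) -(beta_invK v) eq_uv.
Qed.

Lemma phi_beta r : phi (beta G r) = alpha r.
Proof. by rewrite /phi betaK. Qed.

Lemma phi_u1 : phi (u1 G) = 1%g.
Proof. by rewrite -[u1 G]/(beta G (r1 B)) phi_beta alpha_r1. Qed.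

Lemma phi_carrier u : carrier A (phi u).
Proof. exact: alpha_carrier. Qed.

Lemma phi_surj t x : @Xsub A t x -> exists u, phi u = x.
Proof.
move=> Xx; have [r [rx _ _]] := alpha_surj B hcontrollable Xx.
by exists (beta G r); rewrite phi_beta.
Qed.

(** [alpha_inv] inverts [alpha] only on its range, so multiplicativity is proved for a factor with a
    finite start, where [alpha_mulr] supplies a preimage; all elements of the chain have such a
    start. *)
Lemma phi_circr u v t : @Xsub A t (phi v) -> phi (circ G u v) = (phi u * phi v)%g.
Proof.
move=> Xv; rewrite phi_beta /star.
by have [r /alphaK] := alpha_mulr hcomplete hcontrollable (beta_inv u) Xv.
Qed.

Lemma phi_circl u v t : @Xsub A t (phi u) -> phi (circ G u v) = (phi u * phi v)%g.
Proof.
move=> Xu; rewrite phi_beta /star.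
by have [r /alphaK] := alpha_mull hcomplete hcontrollable (beta_inv v) Xu.
Qed.

Lemma lower_groupE (p : 'I_l.+1 * int) :
  @lower_group A l B G p = phi @^-1` (@segment A p.2 (p.2 + p.1%:Z)).
Proof.
apply/seteqP; split=> u.
  move=> u_p; apply/(alpha_segment hcomplete hcontrollable) => q /u_p uq.
  apply: (bij_inj (lab_bij G q)); rewrite -[LHS]/(beta G (beta_inv u) q) beta_invK.
  exact: uq.
move=> /(alpha_segment hcomplete hcontrollable) r1r q /r1r eq_q.
by rewrite -[u]beta_invK /beta eq_q.
Qed.

Lemma phi_generator p (g : basis_elt B p) : phi (generator G p (lab G g)) = sval g.
Proof.
have -> : generator G p (lab G g) = beta G (dfwith (r1 B) g).
  apply: functional_extensionality_dep => q; rewrite /generator /beta.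
  by case: (eqVneq p q) => [<-|ne_pq]; rewrite ?dfwith_in ?dfwith_out.
rewrite phi_beta; exact: alpha_dfwith.
Qed.

(** The common start [t] provides preimages under [phi] for inverses and conjugates of elements of
    [K]. *)
Lemma normal_subgroup_preimage K t : normal_in K -> K `<=` @Xsub A t ->
  normal_subgroup (circ G) (u1 G) (phi @^-1` K).
Proof.
move=> NK KX; have [KA K1 KM KV KJ] := NK; split.
- by rewrite /= phi_u1.
- by move=> u v Ku Kv; rewrite /= (phi_circr _ (KX _ Kv)); apply: KM.
- move=> u Ku; have [v vE] := phi_surj (KX _ (KV _ Ku)).
  have Kv : K (phi v) by rewrite vE; apply: KV.
  exists v; split=> //; apply: phi_inj; rewrite phi_u1.
    by rewrite (phi_circr _ (KX _ Kv)) vE mulgV.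
  by rewrite (phi_circr _ (KX _ Ku)) vE mulVg.
- move=> u; apply/seteqP; split=> _ [v Kv <-].
    have Kuv := KJ _ _ (phi_carrier u) Kv; have [w wE] := phi_surj (KX _ Kuv).
    exists w; first by rewrite /= wE.
    apply: phi_inj; rewrite (phi_circr _ (KX _ Kv)).
    by rewrite (@phi_circl _ _ t) ?wE ?mulgVK //; apply: KX.
  have Kuv := normal_inJV NK (phi_carrier u) Kv.
  have [w wE] := phi_surj (KX _ Kuv).
  exists w; first by rewrite /= wE.
  apply: phi_inj; rewrite (phi_circl _ (KX _ Kv)).
  by rewrite (@phi_circr _ _ t) ?wE -?mulgA ?mulVKg // mulgA; apply: KX.
Qed.

Lemma set_op_preimage K1 K2 t1 t2 : K1 `<=` @Xsub A t1 -> K2 `<=` @Xsub A t2 ->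
  set_op (circ G) (phi @^-1` K1) (phi @^-1` K2) = phi @^-1` (set_op *%g K1 K2).
Proof.
move=> X1 X2; apply/seteqP; split=> u.
  move=> [v K1v [w K2w <-]]; exists (phi v) => //; exists (phi w) => //.
  by rewrite (phi_circr _ (X2 _ K2w)).
move=> [x K1x [y K2y xyE]].
have [v vE] := phi_surj (X1 _ K1x); have [w wE] := phi_surj (X2 _ K2y).
exists v; first by rewrite /= vE.
exists w; first by rewrite /= wE.
by apply: phi_inj; rewrite (@phi_circr _ _ t2) ?vE ?wE ?xyE //; apply: X2.
Qed.

End GeneratorGroup.

(** * Lower triangles and normal fillings *)

Section Triangles.
Variable l : nat.
Implicit Types (p q : 'I_l.+1 * int) (S : set ('I_l.+1 * int)).

Lemma triangle_refl p : triangle p p.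
Proof. by split. Qed.

Lemma triangle_trans p q : triangle p q -> triangle q `<=` triangle p.
Proof. by move=> [? ?] r [? ?]; split; lia. Qed.

Lemma triangle_antisym p q : triangle p q -> triangle q p -> p = q.
Proof.
case: p q => [k t] [m s] [/= ? ?] [/= ? ?].
have -> : t = s by lia.
by congr (_, _); apply: val_inj => /=; lia.
Qed.

(** Lengths are bounded by [l], so among the triangles inside [S] that contain [p] one of greatest
    length exists, and it is maximal. *)
Lemma maximal_triangle_above S p : triangle p `<=` S ->
  exists2 q, maximal_triangle S q & triangle q p.
Proof.
move=> sub_pS.
pose P n :=
  `[< exists q, [/\ triangle q `<=` S, triangle q p & nat_of_ord q.1 = n] >].
have exP : exists n, P n by exists p.1; apply/asboolP; exists p.
have leP n : P n -> (n <= l)%N by move=> /asboolP[q [_ _ <-]]; rewrite -ltnS.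
case: (ex_maxnP exP leP) => n /asboolP[q [qS qp qn]] max_n; exists q => //.
split=> // q' q'S sub_qq'; have q'q := sub_qq' q (triangle_refl q).
have /max_n : P q'.1.
  by apply/asboolP; exists q'; split=> //; apply: sub_qq'.
rewrite -qn => le_q; congr triangle; apply: triangle_antisym => //.
by case: q'q => *; split; lia.
Qed.

Section Fill.
Variable f : nat -> 'I_l.+1 * int.
Hypothesis f_normal : normal_filling f.

Lemma filled_down_closed tau p : [set` mkseq f tau] p ->
  triangle p `<=` [set` mkseq f tau].
Proof.
case: tau => [//|tau]; have [_ /(_ tau.+1 isT) [P ->]] := f_normal.
by move=> [q Pq /triangle_trans sub_pq] r /sub_pq; exists q.
Qed.

Lemma filledS tau p :
  [set` mkseq f tau.+1] p <-> [set` mkseq f tau] p \/ p = f tau.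
Proof.
rewrite /= mkseqS mem_rcons inE; split=> [/orP[/eqP|]|[|->]]; last by rewrite eqxx.
- by right.
- by left.
- by move=> ->; rewrite orbT.
Qed.

Lemma filled_fresh tau : ~ [set` mkseq f tau] (f tau).
Proof.
have [f_fill _] := f_normal; move=> /mapP[i]; rewrite mem_iota => lt_i eq_fi.
have [j [_ j_uniq]] := f_fill (f tau).
by have := j_uniq i (esym eq_fi); rewrite (j_uniq tau erefl); lia.
Qed.

(** A triangle contains its own index; if that index is an old pair, downward closure brings in the
    whole triangle. *)
Lemma filledS_triangle tau q : triangle q `<=` [set` mkseq f tau.+1] ->
  triangle q `<=` [set` mkseq f tau] \/ q = f tau.
Proof.
move=> qS; have /filledS [qt|] := qS q (triangle_refl q); last by right.
by left; apply: filled_down_closed.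
Qed.

End Fill.
End Triangles.

(** * The normal chain inside [A] and its cosets *)

Section Chain.
Variables (A : group_system) (l : nat) (f : nat -> 'I_l.+1 * int).
Implicit Types (p q : 'I_l.+1 * int) (K : set (sequences (alphabet A))).

Definition pair_segment p : set (sequences (alphabet A)) :=
  @segment A p.2 (p.2 + p.1%:Z).

(* The image of L^tau under phi. *)
Definition Kchain tau : set (sequences (alphabet A)) :=
  \big[set_op *%g/[set 1%g]]_(p <- mkseq f tau |
    `[< maximal_triangle [set` mkseq f tau] p >]) pair_segment p.

Lemma normal_in1 : normal_in [set 1%g : sequences (alphabet A)].
Proof.
split.
- by move=> _ ->; apply: carrier1.
- by [].
- by move=> _ _ -> ->; rewrite /= mulg1.
- by move=> _ ->; rewrite /= invg1.
- by move=> a _ _ ->; rewrite /= mulg1 mulgV.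
Qed.

Lemma pair_segment_Xsub p : pair_segment p `<=` @Xsub A p.2.
Proof. by rewrite /pair_segment segmentE => x []. Qed.

(** The three facts are proved together, since carrying a product through [phi] requires both
    factors to have a finite start; the minimum of the two starts serves the product. *)
Lemma Kchain_spec (B : basis A l) (G : labelling B) tau :
    complete A -> controllable A l ->
  [/\ normal_in (Kchain tau), exists t, Kchain tau `<=` @Xsub A t &
      Lchain G f tau = @phi A l B G @^-1` (Kchain tau)].
Proof.
move=> hcomplete hcontrollable; rewrite /Kchain /Lchain.
apply: (big_rec2 (fun L K => [/\ normal_in K, exists t, K `<=` @Xsub A t &
  L = @phi A l B G @^-1` K])) => [|p L K _ [NK [t KX] ->]].
  split; first exact: normal_in1.
    by exists 0 => _ ->; have [] := normal_in_Xsub A 0.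
  apply/seteqP; split=> u /=; first by move=> ->; rewrite phi_u1.
  by rewrite -[RHS](phi_u1 G) => /phi_inj; apply.
split; first by apply: normal_in_set_op => //; apply: normal_in_segment.
  exists (Order.min p.2 t) => _ [x px [y Ky <-]].
  have [_ _ XM _ _] := normal_in_Xsub A (Order.min p.2 t).
  apply: XM; first by apply: Xsub_mono (pair_segment_Xsub px); lia.
  by apply: Xsub_mono (KX _ Ky); lia.
rewrite lower_groupE //; apply: set_op_preimage KX => //.
exact: pair_segment_Xsub.
Qed.

Lemma normal_in_prod (I : Type) (s : seq I) (Q : pred I)
    (F : I -> set (sequences (alphabet A))) :
    (forall i, normal_in (F i)) ->
  normal_in (\big[set_op *%g/[set 1%g]]_(i <- s | Q i) F i).
Proof.
move=> NF; apply: (big_ind (@normal_in A)) => //; first exact: normal_in1.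
by move=> *; apply: normal_in_set_op.
Qed.

Lemma factor_sub_prod (I : eqType) (s : seq I) (Q : pred I)
    (F : I -> set (sequences (alphabet A))) i :
    (forall j, normal_in (F j)) -> i \in s -> Q i ->
  F i `<=` \big[set_op *%g/[set 1%g]]_(j <- s | Q j) F j.
Proof.
move=> NF + Qi; elim: s => // j s IHs; rewrite inE big_cons => /orP[/eqP <-|i_s].
  rewrite Qi => x Fx; exists x => //; exists 1%g; last by rewrite mulg1.
  by have [] := normal_in_prod s Q NF.
case: ifP => _; last exact: IHs.
move=> x Fx; exists 1%g; first by have [] := NF j.
by exists x; [apply: IHs | rewrite mul1g].
Qed.

Lemma normal_in_Kchain tau : normal_in (Kchain tau).
Proof. by apply: normal_in_prod => p; apply: normal_in_segment. Qed.

(** Together with [Kchain_sub] this characterises [Kchain tau] as the least normal subgroup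
    containing the segments of all triangles inside the filled set, so maximality can be forgotten
    afterwards. *)
Lemma Kchain_min K tau : normal_in K ->
    (forall p, triangle p `<=` [set` mkseq f tau] -> pair_segment p `<=` K) ->
  Kchain tau `<=` K.
Proof.
move=> [_ K1 KM _ _] subK; apply: (big_ind (fun K' => K' `<=` K)).
- by move=> _ ->.
- by move=> K1' K2' s1 s2 _ [x /s1 Kx [y /s2 Ky <-]]; apply: KM.
- by move=> p /asboolP[pS _]; apply: subK.
Qed.

Lemma Kchain_sub p tau :
  triangle p `<=` [set` mkseq f tau] -> pair_segment p `<=` Kchain tau.
Proof.
move=> /maximal_triangle_above [q q_max [le_qp le_pq]].
have sub_pq : pair_segment p `<=` pair_segment q by apply: segment_mono.
apply: (subset_trans sub_pq); apply: (factor_sub_prod (F := pair_segment)).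
- by move=> r; apply: normal_in_segment.
- by have [qS _] := q_max; apply/qS/triangle_refl.
- exact/asboolP.
Qed.

Hypothesis f_normal : normal_filling f.

Lemma Kchain_mono tau : Kchain tau `<=` Kchain tau.+1.
Proof.
apply: Kchain_min (normal_in_Kchain _) _ => p pS; apply: Kchain_sub => q /pS qS.
by apply/filledS; left.
Qed.

Lemma pair_segment_KchainS tau : pair_segment (f tau) `<=` Kchain tau.+1.
Proof.
by apply: Kchain_sub; apply: filled_down_closed => //; apply/filledS; right.
Qed.

Lemma KchainS_sub tau :
  Kchain tau.+1 `<=` set_op *%g (Kchain tau) (pair_segment (f tau)).
Proof.
have NK := normal_in_Kchain tau.
have NS := normal_in_segment A (f tau).2 ((f tau).2 + (f tau).1%:Z).
apply: Kchain_min => [|p /(filledS_triangle f_normal) [pS|->] x px].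
- exact: normal_in_set_op.
- exists x; first exact: (Kchain_sub pS).
  by exists 1%g; [case: NS | rewrite mulg1].
- by exists 1%g; [case: NK | exists x; rewrite ?mul1g].
Qed.

(* A triangle that avoids [(k, t)] either starts after [t] or ends before
   [t + k]. *)
Lemma Kchain_segment_XXY tau (k : 'I_l.+1) t : f tau = (k, t) ->
  Kchain tau `&` @segment A t (t + k%:Z) `<=` @XXY A t (t + k%:Z - 1).
Proof.
move=> ftau x [Kx]; rewrite segmentE => -[Xx _].
have NX := normal_in_Xsub A; have NY := normal_in_Ysub A.
have sub : Kchain tau `<=` set_op *%g (@Xsub A (t + 1)) (@Ysub A (t + k%:Z - 1)).
  apply: Kchain_min => [|[m s] pS y]; first exact: normal_in_set_op.
  rewrite /pair_segment segmentE => -[Xy Yy].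
  have [lt_ts|le_st] := ltP t s.
    exists y; first by apply: Xsub_mono Xy => /=; lia.
    by exists 1%g; [case: (NY (t + k%:Z - 1)) | rewrite mulg1].
  exists 1%g; first by case: (NX (t + 1)).
  exists y; last by rewrite mul1g.
  apply: Ysub_mono Yy => /=; apply: contrapT => nle.
  apply: (filled_fresh f_normal (tau := tau)); apply: pS; rewrite ftau.
  by split=> /=; lia.
(* Since [x] and [a] both start at [t] or later, so does [b = a^-1 * x]. *)
have [a Xa [b Yb abE]] := sub x Kx; exists a => //; exists b => //; split=> //.
have [_ _ XM XV _] := NX t.
have -> : b = (a^-1 * x)%g by rewrite -abE mulKg.
by apply: XM => //; apply: XV; apply: Xsub_mono Xa; lia.
Qed.

Lemma segment_coset (B : basis A l) tau x : pair_segment (f tau) x ->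
  exists g : basis_elt B (f tau), Kchain tau (sval g * x^-1)%g.
Proof.
have [_ _ KM _ _] := normal_in_Kchain tau.
(* Such a triangle lies in the filled set at [tau.+1] by downward closure, and by antisymmetry it
   misses the new pair [f tau]. *)
have below p : triangle (f tau) p -> p <> f tau -> pair_segment p `<=` Kchain tau.
  move=> tri ne; apply: Kchain_sub => q pq.
  have /filledS [//|q_f] : [set` mkseq f tau.+1] q.
    apply: (filled_down_closed f_normal (p := f tau)).
      by apply/filledS; right.
    exact: triangle_trans pq.
  by case: ne; apply: triangle_antisym; rewrite -?q_f // q_f.
move: below; case: (f tau) => k t below Sx.
have Nx : @XXY A t (t + k%:Z) x by apply: XXY_meet; rewrite -segmentE.
have [sub uniq] := gens_transversal B k t.
have [g [[Bg [n Nn nxg]] _]] := uniq x Nx.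
exists (exist _ g Bg); rewrite /= -nxg mulgK.
have Sn : @segment A t (t + k%:Z) n.
  have [_ _ SM SV _] := normal_in_segment A t (t + k%:Z).
  have -> : n = (g * x^-1)%g by rewrite -nxg mulgK.
  by apply: SM; [apply: gens_segment Bg | apply: SV].
case: Nn => a Xa [b Sb abE]; rewrite -segmentE in Sb.
(* Both [n] and [b] end by [t + k], hence so does [a]. *)
have Sa : @segment A (t + 1) (t + k%:Z) a.
  have [_ _ YM YV _] := normal_in_Ysub A (t + k%:Z).
  rewrite segmentE; split=> //; have -> : a = (n * b^-1)%g by rewrite -abE mulgK.
  apply: YM; first by move: Sn; rewrite segmentE => -[].
  by apply: YV; move: Sb; rewrite segmentE => -[_]; apply: Ysub_mono; lia.
(* For [k = 0] there is no smaller triangle, but both segments are empty and the factors are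
   trivial. *)
rewrite -abE; case: (posnP k) => [k0|k_gt0].
  have -> : b = 1%g by apply: segment_empty Sb; lia.
  have -> : a = 1%g by apply: segment_empty Sa; lia.
  by rewrite mulg1; have [] := normal_in_Kchain tau.
have k1 : nat_of_ord (inord k.-1 : 'I_l.+1) = k.-1.
  by rewrite inordK //; have := ltn_ord k; lia.
have ne s : (inord k.-1 : 'I_l.+1, s) <> (k, t).
  by case=> /(congr1 val); rewrite /= k1; lia.
apply: KM.
  apply: (below (inord k.-1, t + 1)) => //; first by split; rewrite /= ?k1; lia.
  by rewrite /pair_segment /= k1; have -> : t + 1 + k.-1%:Z = t + k%:Z by lia.
apply: (below (inord k.-1, t)) => //; first by split; rewrite /= ?k1; lia.
by rewrite /pair_segment /= k1; have -> : t + k.-1%:Z = t + k%:Z - 1 by lia.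
Qed.
End Chain.

Theorem theorem59 (A : group_system) (l : nat) (B : basis A l)
    (G : labelling B) (f : nat -> 'I_l.+1 * int)
    (hcontrollable : controllable A l) (hcomplete : complete A)
    (hf : normal_filling f) :
  normal_chain (circ G) (u1 G) (Lchain G f) /\
  forall tau : nat,
    coset_representatives (circ G) (Lchain G f tau.+1) (Lchain G f tau)
      (range (generator G (f tau))).
Proof.
have LE tau : Lchain G f tau = @phi A l B G @^-1` (@Kchain A l f tau).
  by have [] := Kchain_spec f G tau hcomplete hcontrollable.
split; first split=> [|i]; first by rewrite /Lchain big_nil.
  have [NK [t KX] _] := Kchain_spec f G i hcomplete hcontrollable.
  split; first by rewrite LE; apply: normal_subgroup_preimage KX.
  by rewrite !LE => u; apply: Kchain_mono.
move=> tau; have [NK [t KX] _] := Kchain_spec f G tau hcomplete hcontrollable.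
have [_ K1 KM KV KJ] := NK.
have genE p (h : label G p) : exists2 g : basis_elt B p,
    phi (generator G p h) = sval g & h = lab G g.
  have [c _ cK] := lab_bij G p; exists (c h) => //.
  by rewrite -{1}[h]cK phi_generator.
rewrite !LE; split=> [_ [h _ <-]|u Ku].
  have [g gE _] := genE _ h; rewrite /= gE.
  by apply: pair_segment_KchainS => //; apply: (gens_sub (svalP g)).
have [x Kx [y Sy xyE]] := KchainS_sub hf Ku.
have [g Kg] := segment_coset hf B Sy.
(* Coset membership is restated in [A]; the translation works because [Kchain] has a finite start,
   even if [u] and [v] have none. *)
have rcosetP v : @Kchain A l f tau (phi v * (phi u)^-1)%g <->
    rcoset_of (circ G) (@phi A l B G @^-1` @Kchain A l f tau) u v.
  split=> [Kvu|[n Kn <-]]; last by rewrite (phi_circl _ _ _ (KX _ Kn)) // mulgK.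
  have [n nE] := phi_surj G hcontrollable (KX _ Kvu).
  exists n; first by rewrite /= nE.
  apply: (phi_inj hcomplete).
  by rewrite (@phi_circl _ _ _ _ _ _ _ _ t) ?nE ?mulgVK //; apply: KX.
(* With [phi u = x * y], the quotient is [(g * y^-1) * x^-1], a product of two elements of
   [Kchain]. *)
have Ku' : @Kchain A l f tau (phi (generator G (f tau) (lab G g)) * (phi u)^-1)%g.
  rewrite phi_generator -xyE invgM mulgA.
  by apply: (KM) => //; apply: KV.
exists (generator G (f tau) (lab G g)); split.
  by split; [exists (lab G g) | apply/rcosetP].
move=> _ [[h _ <-] /rcosetP Kh]; have [g' g'E ->] := genE _ h.
rewrite g'E in Kh; rewrite phi_generator in Ku'.
congr (generator _ _ (lab _ _)); apply: basis_elt_inj.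
(* Two representatives of one coset differ by an element of [Kchain] that also lies in the segment
   of [f tau], hence in the subgroup defining the transversal, which forces equality. *)
have : @Kchain A l f tau (sval g * (sval g')^-1)%g.
  by have := KM _ _ Ku' (KV _ Kh); rewrite invgM invgK mulgA mulgVK.
clear -hf; have := @Kchain_segment_XXY A l f hf tau; move: g g'.
case: (f tau) => k s g g' sub Kgg'.
apply: gens_uniq (svalP g') (svalP g) _; apply: sub => //; split=> //.
have [_ _ SM SV _] := normal_in_segment A s (s + k%:Z).
by apply: SM; [|apply: SV]; apply: gens_segment; apply: svalP.
Qed.
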